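(* There is a function $f(\cdot,\cdot)$ such that, for every $\varepsilon>0$, every graph $G$ of highway dimension $\eta$, and every vertex $s$ of $G$, there exists a graph $H$ and an embedding $\phi$ of the vertices of $G$ into the vertices of $H$ such that $H$ has treewidth at most $f(\varepsilon,\eta)$, and for all vertices $u,v$ of $G$, $$d_G(u,v)\le d_H(\phi(u),\phi(v))\le d_G(u,v)+\varepsilon\big(d_G(s,u)+d_G(s,v)\big).$$
   Context: Graphs are undirected with positive edge lengths; $d_G(u,v)$ is the shortest-path distance in $G$ and $B_v(r)=\{u : d_G(u,v)\le r\}$. Fix a constant $c>4$. The highway dimension of $G$ is the smallest integer $\eta$ such that for every $r>0$ and every vertex $v$ there is a set of at most $\eta$ vertices in $B_v(cr)$ such that every shortest path contained in $B_v(cr)$ of length at least $r$ contains a vertex of this set. *)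

(* Defs.v *)
From HB Require Import structures.
From mathcomp Require Import all_boot all_order all_algebra.
From mathcomp Require Import all_classical all_reals all_analysis.

Set Implicit Arguments.
Unset Strict Implicit.
Unset Printing Implicit Defensive.

Import Order.TTheory GRing.Theory Num.Theory.
Local Open Scope ring_scope.

(* Only the values of [len] on edges are meaningful. *)
Record wgraph (R : realType) := WGraph {
  vert :> finType;
  edge : rel vert;
  len : vert -> vert -> R;
  edge_sym : symmetric edge;
  edge_irr : irreflexive edge;
  len_sym : forall u v, len u v = len v u;
  len_gt0 : forall u v, edge u v -> 0 < len u v
}.

Section Distance.
Variables (R : realType) (G : wgraph R).

(* As in path.v, the path x_0, ..., x_n is given by its first vertex x_0 and
   the sequence of the remaining ones. *)
Definition is_path (u v : G) (p : seq G) : bool :=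
  [&& path (@edge R G) u p, last u p == v & uniq (u :: p)].

Fixpoint path_len (u : G) (p : seq G) : R :=
  if p is v :: q then len u v + path_len v q else 0.

(* The infimum of the empty set is +oo, so vertices in different components are
   at distance +oo; otherwise the infimum is over a finite nonempty set. *)
Definition dist (u v : G) : \bar R :=
  ereal_inf [set (path_len u p)%:E | p in [set p | is_path u v p]]%classic.

Definition is_shortest_path (u v : G) (p : seq G) : Prop :=
  is_path u v p /\ (path_len u p)%:E = dist u v.

Definition gball (v : G) (r : R) : {set G} :=
  [set u : G | (dist u v <= r%:E)%E].

Definition highway_bound (c : R) (k : nat) : Prop :=
  forall (r : R) (v : G), 0 < r ->
  exists S : {set G},
    [/\ S \subset gball v (c * r),
        (#|S| <= k)%N &
        forall (x y : G) (p : seq G),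
          is_shortest_path x y p ->
          {subset x :: p <= gball v (c * r)} ->
          r <= path_len x p ->
          exists2 w, w \in S & w \in x :: p].

Lemma highway_bound_ex (c : R) : exists k, `[< highway_bound c k >].
Proof.
exists #|G|; apply/asboolP => r v _; exists (gball v (c * r)).
split; [exact: subxx | exact: max_card | move=> x y p _ sub _].
by exists x; rewrite ?mem_head// sub ?mem_head.
Qed.

Definition highway_dim (c : R) : nat := ex_minn (highway_bound_ex c).

End Distance.

Record is_tree (T : finType) (e : rel T) : Prop := IsTree {
  tree_sym : symmetric e;
  tree_irr : irreflexive e;
  tree_nonempty : (0 < #|T|)%N;
  tree_connected : forall x y, connect e x y;
  tree_acyclic : forall p : seq T, (2 < size p)%N -> ~ ucycle e p
}.

Section Treewidth.
Variables (R : realType) (G : wgraph R).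

Record is_tree_decomp (T : finType) (e : rel T) (bag : T -> {set G}) : Prop :=
  IsTreeDecomp {
    td_tree : is_tree e;
    td_vertex : forall v : G, exists t, v \in bag t;
    td_edge : forall u v : G, edge u v ->
      exists t, (u \in bag t) && (v \in bag t);
    td_subtree : forall (v : G) (t t' : T), v \in bag t -> v \in bag t' ->
      connect [rel a b | [&& e a b, v \in bag a & v \in bag b]] t t'
  }.

(* Truncated subtraction: the graph without vertices gets width 0, not -1. *)
Definition td_width (T : finType) (bag : T -> {set G}) : nat :=
  (\max_(t : T) #|bag t|).-1.

Definition has_td_width (k : nat) : Prop :=
  exists (T : finType) (e : rel T) (bag : T -> {set G}),
    is_tree_decomp e bag /\ td_width bag = k.

Lemma has_td_width_ex : exists k, `[< has_td_width k >].
Proof.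
exists (td_width (fun _ : unit => [set: G])); apply/asboolP.
exists unit, (fun _ _ => false), (fun=> [set: G]); split=> //; split.
- split=> //; first by rewrite card_unit.
  + by move=> [] []; exact: connect0.
  + move=> p ps /andP[_ /card_uniqP pE].
    by have := max_card (mem p); rewrite pE card_unit leqNgt (ltn_trans _ ps).
- by move=> v; exists tt; rewrite inE.
- by move=> u v _; exists tt; rewrite !inE.
- by move=> v [] [] _ _; exact: connect0.
Qed.

Definition treewidth : nat := ex_minn has_td_width_ex.

End Treewidth.

(* Main.v *)
Require Import Defs.
From HB Require Import structures.
From mathcomp Require Import all_boot all_order all_algebra.
From mathcomp Require Import all_classical all_reals all_analysis.
From mathcomp Require Import lra.

Set Implicit Arguments.
Unset Strict Implicit.
Unset Printing Implicit Defensive.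

Import Order.TTheory GRing.Theory Num.Theory.
Local Open Scope ring_scope.

(* Call a set of diameter < tau at distance > tau from its complement a town of
   scale tau; towns form a laminar family. Put lam = c / 4 > 1. The at most eta
   hubs of the ball of radius c rho around h show that every u within 2 lam rho
   of h lies in a town of scale rho or within 2 rho of a hub, and that they hit
   every shortest path from u of length between rho and 2 lam rho. Iterating
   over the scales rho / lam^j around the hubs already found gives, for each
   ball of radius 2 lam rho, a bounded set of portals through which all pairs
   of vertices are joined up to an error of order eps rho, except pairs lying
   in a common smaller town that avoids the centre.

   At level k, of scale sigma_k proportional to lam^k, let the vertices within
   about sigma_k of s form one class and let the others be grouped into their
   maximal towns of scale O(sigma_k) avoiding s. These nested partitions form a
   tree. Each class carries the portals of its centre (s for the central class),
   which serve the pairs separated at level k - 1. A town avoiding s is at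
   roughly constant distance from s, so the levels at which an error
   eps d(s,u) matters and d(s,u) is not negligible against sigma_k form a
   window of bounded length. Joining u to s and to copies of the portals of the
   classes of u inside this window gives H, and the tree of classes, with bags
   truncated to windows, is a tree decomposition of bounded width. *)

(** * Distances in weighted graphs *)

Section GraphDistance.
Variables (R : realType) (G : wgraph R).
Implicit Types (u v w : G) (p q : seq G).

Lemma path_len_cat u p q :
  path_len u (p ++ q) = path_len u p + path_len (last u p) q.
Proof. by elim: p u => [|w p IH] u /=; rewrite ?add0r// IH addrA. Qed.

Lemma path_len_ge0 u p : path (@edge R G) u p -> 0 <= path_len u p.
Proof.
elim: p u => [//|w p IH] u /= /andP[euw pw].
by rewrite addr_ge0 ?IH// ltW// len_gt0.
Qed.

(** When the first vertex recurs, the closed part before the recurrence is cut off, which only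
    shortens the walk. So distances can be bounded by walks, which concatenate, although [dist]
    ranges over simple paths. *)
Lemma simple_path_of_walk u p : path (@edge R G) u p ->
  exists2 q, is_path u (last u p) q & path_len u q <= path_len u p.
Proof.
elim: p u => [|w p IH] u /=; first by exists [::]; rewrite ?lexx// /is_path /= eqxx.
move=> /andP[euw /IH[q]]; rewrite /is_path => /and3P[pq /eqP lq uq] le_qp.
have [|u_nq] := boolP (u \in w :: q); last first.
  exists (w :: q); last by rewrite /= lerD2l.
  by apply/and3P; split; rewrite /= ?euw ?lq ?eqxx//; apply/andP.
rewrite inE => /predU1P[u_w|u_q]; first by rewrite u_w edge_irr in euw.
case/splitPr: u_q pq lq uq le_qp => q1 q2.
rewrite cat_path last_cat /= => /and3P[pq1 eq1 pq2] lq uq le_qp.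
exists q2.
  rewrite pq2 lq eqxx /=.
  by move: uq => /andP[_]; rewrite cat_uniq => /and3P[_ _ /= ->].
apply: (le_trans (y := path_len w p)); last by rewrite lerDr ltW// len_gt0.
apply: le_trans le_qp; rewrite path_len_cat /= addrA lerDr.
by rewrite addr_ge0 ?path_len_ge0// ltW// len_gt0.
Qed.

Lemma dist_le_walk u v p : path (@edge R G) u p -> last u p = v ->
  (dist u v <= (path_len u p)%:E)%E.
Proof.
move=> pp <-; have [q qp le_qp] := simple_path_of_walk pp.
apply: (@le_trans _ _ (path_len u q)%:E); last by rewrite lee_fin.
by apply: ereal_inf_lbound; exists q.
Qed.

Lemma le_dist (x : \bar R) u v :
  (forall p, path (@edge R G) u p -> last u p = v -> (x <= (path_len u p)%:E)%E) ->
  (x <= dist u v)%E.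
Proof.
move=> xP; apply: le_ereal_inf_tmp => _ [p /and3P[pp /eqP lp _] <-].
exact: xP.
Qed.

Lemma dist_ge0 u v : (0 <= dist u v)%E.
Proof. by apply: le_dist => p pp _; rewrite lee_fin path_len_ge0. Qed.

Lemma distxx u : dist u u = 0%E.
Proof.
apply/eqP; rewrite eq_le dist_ge0 andbT.
exact: (@dist_le_walk u u [::]).
Qed.

Lemma reverse_walk u p : path (@edge R G) u p ->
  exists q, [/\ path (@edge R G) (last u p) q, last (last u p) q = u &
                path_len (last u p) q = path_len u p].
Proof.
elim: p u => [|w p IH] u /=; first by exists [::].
move=> /andP[euw /IH[q [pq lq len_q]]]; exists (rcons q u).
rewrite rcons_path pq lq edge_sym euw last_rcons -cats1 path_len_cat lq len_q.
by rewrite /= addr0 addrC len_sym.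
Qed.

Lemma dist_sym u v : dist u v = dist v u.
Proof.
suff le_d : forall a b : G, (dist a b <= dist b a)%E by apply/eqP; rewrite eq_le !le_d.
move=> a b; apply: (@le_dist (dist a b) b a) => p pp lp.
have [q] := reverse_walk pp; rewrite lp => -[pq lq <-].
exact: dist_le_walk.
Qed.

Lemma dist_attained u v : connect (@edge R G) u v ->
  exists p, is_shortest_path u v p.
Proof.
move=> /connectP[p0 /simple_path_of_walk[q q_path _] vE].
rewrite -vE in q_path.
(* Simple paths have bounded size, so they live in a finite type and a shortest one exists. *)
have size_path p : is_path u v p -> (size p <= #|G|)%N.
  move=> /and3P[_ _ /card_uniqP uE].
  by have := max_card (mem (u :: p)); rewrite uE; exact: ltnW.
pose q0 : {bseq #|G| of G} := Bseq (size_path _ q_path).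
pose P (p : {bseq #|G| of G}) := is_path u v p.
case: (@arg_minP _ _ _ q0 P (fun p : {bseq #|G| of G} => path_len u p) q_path).
move=> p pP p_min; exists p; split=> //; apply/eqP; rewrite eq_le; apply/andP; split.
  apply: le_ereal_inf_tmp => _ [r r_path <-]; rewrite lee_fin.
  exact: (p_min (Bseq (size_path _ r_path))).
by apply: ereal_inf_lbound; exists (p : seq G).
Qed.

Lemma dist_fin_num u v : connect (@edge R G) u v -> dist u v \is a fin_num.
Proof. by case/dist_attained=> p [_ <-]. Qed.

Lemma connect_edge_sym : connect_sym (@edge R G).
Proof. exact/sym_connect_sym/edge_sym. Qed.

Lemma dist_pinfty u v : ~~ connect (@edge R G) u v -> dist u v = +oo%E.
Proof.
move=> n_uv; apply/eqP; rewrite -leye_eq; apply: le_dist => p pp lp.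
by case/negP: n_uv; apply/connectP; exists p.
Qed.

Lemma dist_fin_connect u v : dist u v \is a fin_num -> connect (@edge R G) u v.
Proof. by apply: contraTT => /dist_pinfty ->. Qed.

Lemma dist_triangle u v w : (dist u w <= dist u v + dist v w)%E.
Proof.
have [uv|/dist_pinfty ->] := boolP (connect (@edge R G) u v); last first.
  by rewrite addye ?leey// gt_eqF// (lt_le_trans _ (dist_ge0 _ _))// ltNyr.
have [vw|/dist_pinfty ->] := boolP (connect (@edge R G) v w); last first.
  by rewrite addey ?leey// gt_eqF// (lt_le_trans _ (dist_ge0 _ _))// ltNyr.
have [p [/and3P[pp /eqP lp _] <-]] := dist_attained uv.
have [q [/and3P[pq /eqP lq _] <-]] := dist_attained vw.
rewrite -EFinD -{1}lp -path_len_cat; apply: dist_le_walk.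
  by rewrite cat_path pp lp.
by rewrite last_cat lp.
Qed.

Lemma dist_eq0 u v : dist u v = 0%E -> u = v.
Proof.
move=> d0; have uv : connect (@edge R G) u v by apply: dist_fin_connect; rewrite d0.
have [[|w p] [/and3P[pp /eqP lp _] lenE]] := dist_attained uv; first exact: lp.
move: pp lenE; rewrite d0 /= => /andP[euw pp] [] /eqP.
by rewrite gt_eqF// ltr_pwDl ?path_len_ge0// len_gt0.
Qed.

Lemma shortest_path_between u v p w : is_shortest_path u v p -> w \in u :: p ->
  (dist u w + dist w v <= dist u v)%E.
Proof.
move=> [/and3P[pp /eqP lp _] <-]; rewrite inE => /predU1P[->|].
  by rewrite distxx add0e dist_le_walk.
move=> w_p; case/splitPr: w_p pp lp => p1 p2.
rewrite cat_path last_cat /= => /and3P[pp1 e1 pp2] lp.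
rewrite path_len_cat /= addrA EFinD; apply: leeD; last exact: dist_le_walk.
have <- : path_len u (rcons p1 w) = path_len u p1 + len (last u p1) w.
  by rewrite -cats1 path_len_cat /= addr0.
by apply: dist_le_walk; rewrite ?rcons_path ?pp1 ?last_rcons.
Qed.

End GraphDistance.

(** * Tree decompositions from parent functions *)

Section ParentTree.
Variables (T : finType) (par : T -> T) (root : T) (rk : T -> nat).
Hypothesis par_root : par root = root.
Hypothesis rk_par : forall t, t != root -> (rk t < rk (par t))%N.

(** The inequality removes the loop at the root, which is its own parent. *)
Definition parent_edge : rel T :=
  [rel a b | (a != b) && ((par a == b) || (par b == a))].

Lemma par_neq t : t != root -> t != par t.
Proof. by move=> /rk_par; apply: contraTneq => <-; rewrite ltnn. Qed.

(** Ranks increase towards the root, so the induction is on the gap between the largest rank and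
    [rk t]. *)
Lemma rk_ind (P : T -> Prop) : P root ->
  (forall t, t != root -> P (par t) -> P t) -> forall t, P t.
Proof.
move=> Proot Ppar t; have [n] := ubnP (\max_x rk x - rk t).
elim: n t => // n IH t lt_n; have [->//|t_nroot] := eqVneq t root.
apply: Ppar => //; apply: IH; have := rk_par t_nroot.
have := leq_bigmax (F := rk) (par t); set m := \max_x _ => le_m lt_par.
by rewrite -ltnS; apply: leq_trans lt_n; rewrite ltnS ltn_sub2l// (leq_trans lt_par).
Qed.

Lemma parent_edge_sym : symmetric parent_edge.
Proof. by move=> a b; rewrite /parent_edge /= eq_sym orbC. Qed.

Lemma parent_edge_par t : t != root -> parent_edge t (par t).
Proof. by move=> /par_neq t_npar; rewrite /parent_edge /= t_npar eqxx. Qed.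

Lemma parent_edge_rk a b : parent_edge a b -> (rk a <= rk b)%N -> b = par a.
Proof.
move=> /andP[a_nb /predU1P[//|/eqP aE]] le_ab.
have [b_root|/rk_par] := eqVneq b root; last by rewrite aE ltnNge le_ab.
by move: a_nb; rewrite -aE b_root par_root eqxx.
Qed.

(* A vertex of minimal rank on a cycle has its parent as both neighbours. *)
Lemma parent_edge_acyclic (p : seq T) : (2 < size p)%N -> ~ ucycle parent_edge p.
Proof.
case: p => [//|x0 p0] size_p /andP[cyc_p uniq_p].
set p := x0 :: p0 in size_p cyc_p uniq_p *.
have x0_p : x0 \in p by rewrite mem_head.
case: (@arg_minnP _ x0 (fun x => x \in p) rk x0_p) => x x_p x_min.
have nx_p : next p x \in p by rewrite mem_next.
have px_p : prev p x \in p by rewrite mem_prev.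
have nE : next p x = par x by apply: parent_edge_rk (x_min _ nx_p); exact: next_cycle.
have pE : prev p x = par x.
  apply: parent_edge_rk (x_min _ px_p); rewrite parent_edge_sym.
  exact: prev_cycle.
(* Once the cycle is rotated to start at [x], the neighbours of [x] are its second and last entries,
   distinct as there are more than two. *)
have [i q qE] := rot_to x_p.
have uniq_q : uniq (x :: q) by rewrite -qE rot_uniq.
have size_q : (2 < size (x :: q))%N by rewrite -qE size_rot.
move: nE pE; rewrite -(next_rot i uniq_p) -(prev_rot i uniq_p) qE.
case: q uniq_q size_q {qE} => [//|y [//|z q]] uniq_q _ nE pE.
have : next [:: x, y, z & q] x = y by rewrite /= eqxx.
have : prev [:: x, y, z & q] x = last z q.
  rewrite prev_nth mem_head memNindex; last by case/andP: uniq_q.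
  exact: (nth_last x [:: x, y, z & q]).
rewrite nE pE => -> yE; move: uniq_q => /= /and3P[_ /negP[]].
by rewrite -yE mem_last.
Qed.

Lemma parent_edge_tree : is_tree parent_edge.
Proof.
split.
- exact: parent_edge_sym.
- by move=> a; rewrite /parent_edge /= eqxx.
- by apply/card_gt0P; exists root.
- have to_root a : connect parent_edge a root.
    elim/rk_ind: a => [|t t_nroot]; first exact: connect0.
    exact/connect_trans/connect1/parent_edge_par.
  move=> x y; apply: connect_trans (to_root x) _.
  by rewrite (sym_connect_sym parent_edge_sym).
- exact: parent_edge_acyclic.
Qed.

(** Every node whose bag holds [v] is linked to [top v] through successive parents that also hold
    [v], so the nodes of [v] are connected. *)
Lemma treewidth_le_of_parent (R : realType) (G : wgraph R)
    (bag : T -> {set G}) (top : G -> T) (k : nat) :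
    (forall v, v \in bag (top v)) ->
    (forall v t, v \in bag t -> t != top v -> t != root /\ v \in bag (par t)) ->
    (forall u v : G, edge u v -> exists t, (u \in bag t) && (v \in bag t)) ->
    (forall t, (#|bag t| <= k.+1)%N) ->
  (treewidth G <= k)%N.
Proof.
move=> bag_top bag_par bag_edge bag_card.
apply: (@leq_trans (td_width bag)); last first.
  by rewrite /td_width -subn1 leq_subLR add1n; apply/bigmax_leqP => t _.
rewrite /treewidth; case: ex_minnP => n _; apply; apply/asboolP.
exists T, parent_edge, bag; split=> //; split=> //.
- exact: parent_edge_tree.
- by move=> v; exists (top v).
- move=> v t t' vt vt'.
  set e := [rel a b | _].
  have e_sym : symmetric e.
    move=> a b; rewrite /e /= [parent_edge a b]parent_edge_sym.
    by rewrite [(v \in bag a) && _]andbC.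
  have to_top a : v \in bag a -> connect e a (top v).
    elim/rk_ind: a => [v_root|a a_nroot IH va].
      have [->|/(bag_par _ _ v_root)[]] := eqVneq root (top v); first exact: connect0.
      by rewrite eqxx.
    have [->|/(bag_par _ _ va)[_ v_par]] := eqVneq a (top v); first exact: connect0.
    apply: connect_trans (IH v_par); apply: connect1.
    by rewrite /e /= va v_par !andbT; exact: parent_edge_par.
  apply: connect_trans (to_top _ vt) _.
  by rewrite (sym_connect_sym e_sym); exact: to_top.
Qed.

End ParentTree.

(** * Towns and portals in a finite metric space *)

Lemma exists_expr_ge (R : realType) (lam x : R) : 1 < lam ->
  exists n : nat, x <= lam ^+ n.
Proof.
move=> lam1; have lamB : 0 < lam - 1 by rewrite subr_gt0.
have bernoulli n : n%:R * (lam - 1) <= lam ^+ n.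
  elim: n => [|n IH]; first by rewrite mul0r expr0.
  have : 1 <= lam ^+ n by rewrite exprn_ege1// ltW.
  rewrite exprS -natr1; nra.
exists (Num.bound (`|x| / (lam - 1))).
apply: le_trans (bernoulli _); apply: le_trans (ler_norm x) _.
rewrite -ler_pdivrMr// ltW//; apply: le_lt_trans (archi_boundP _) => //.
by rewrite divr_ge0// ltW.
Qed.

Section HubMetric.
Variables (R : realType) (X : finType) (d : X -> X -> R).
Hypothesis dxx : forall x, d x x = 0.
Hypothesis d_gt0 : forall x y, x != y -> 0 < d x y.
Hypothesis dC : forall x y, d x y = d y x.
Hypothesis d_triangle : forall x y z, d x z <= d x y + d y z.

Lemma d_ge0 x y : 0 <= d x y.
Proof. by have [->|/d_gt0/ltW//] := eqVneq x y; rewrite dxx. Qed.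

(* The open ball of radius tau around u has diameter < tau and lies at distance
   > tau from its complement. *)
Definition town (tau : R) (u : X) : Prop := forall a b, d u a < tau ->
  (d u b < tau -> d a b < tau) /\ (tau <= d u b -> tau < d a b).

Lemma town_mem tau u v a : town tau u -> d u v < tau ->
  (d v a < tau) = (d u a < tau).
Proof.
move=> Tu uv; have [in_a out_a] := Tu v a uv.
apply/idP/idP => [va|/in_a//]; rewrite ltNge; apply/negP => /out_a; lra.
Qed.

Lemma town_move tau u v : town tau u -> d u v < tau -> town tau v.
Proof.
move=> Tu uv a b; rewrite (town_mem a Tu uv) => /(Tu a b)[in_b out_b].
rewrite (town_mem b Tu uv); split=> // le_vb; apply: out_b.
by rewrite leNgt -(town_mem b Tu uv) -leNgt.
Qed.

Variables (eta : nat) (lam : R).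
Hypothesis lam_gt1 : 1 < lam.
(** Metric form of the highway bound with c = 4 lam: points with d(a,z) + d(z,b) = d(a,b) stand for
    the vertices of shortest paths. *)
Hypothesis hubs : forall h rho, 0 < rho -> exists S : {set X},
  (#|S| <= eta)%N /\
  forall a b, (forall z, d a z + d z b = d a b -> d z h <= 4 * (lam * rho)) ->
    rho <= d a b -> exists2 w, w \in S & d a w + d w b = d a b.

(** If no hub is within 2 rho of [u], no point lies at distance between rho and 2 rho from [u],
    since a shortest path to it would carry such a hub; nor are two points of the ball at distance
    rho or more, for the same reason. So the ball is a town. *)
Lemma local_hubs h rho : 0 < rho -> exists S : {set X},
  (#|S| <= eta)%N /\
  forall u, d u h <= 2 * (lam * rho) ->
    (forall v, rho <= d u v -> d u v <= 2 * (lam * rho) ->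
       exists2 w, w \in S & d u w + d w v = d u v) /\
    (town rho u \/ exists2 w, w \in S & d u w <= 2 * rho).
Proof.
move=> rho0; have [S [cardS hitS]] := hubs h rho0.
have rho_lam : rho < lam * rho by rewrite ltr_pMl.
exists S; split=> // u uh.
have hit_u v : rho <= d u v -> d u v <= 2 * (lam * rho) ->
    exists2 w, w \in S & d u w + d w v = d u v.
  move=> le_uv uv; apply: hitS => // z zE.
  have := d_triangle z u h; rewrite (dC z u); have := d_ge0 z v; lra.
split=> //; apply/or_asboolP; rewrite -implyNb; apply/implyP => /negP nT.
apply/asboolP; apply: contrapT => far; apply: nT; apply/asboolP.
have {}far w : w \in S -> 2 * rho < d u w.
  by move=> wS; rewrite ltNge; apply/negP => uw; apply: far; exists w.
have gap b : rho <= d u b -> 2 * rho < d u b.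
  move=> le_ub; rewrite ltNge; apply/negP => ub.
  have [|w /far + wE] := hit_u b le_ub; first by lra.
  by have := d_ge0 w b; lra.
move=> a b ua; split=> [ub|/gap ub]; last by have := d_triangle u a b; lra.
rewrite ltNge; apply/negP => ab.
have ab2 : d a b < 2 * rho by have := d_triangle a u b; rewrite (dC a u); lra.
(* a point of a shortest path from a to b is within rho of a or of b *)
have near_u z : d a z + d z b = d a b -> d u z < 2 * rho.
  move=> zE; have := d_triangle u a z; have := d_triangle u b z.
  by rewrite (dC b z); lra.
have [z zE|//|w /far + /near_u] := hitS a b; last by lra.
by have := d_triangle z u h; rewrite (dC z u); have := near_u z zE; lra.
Qed.

(* Each round either catches the pair u, v, or finds a town avoiding x that
   contains it, or divides the scale by lam. *)
Lemma portal_set (J : nat) x rho : 0 < rho -> exists Q : {set X},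
  [/\ (#|Q| <= eta.+1 ^ J)%N, x \in Q &
  forall u v, d x u <= 2 * (lam * rho) -> d u v <= 2 * (lam * rho) ->
    (exists2 p, p \in Q & d u p + d p v <= d u v + 4 * (lam * (rho / lam ^+ J))) \/
    exists tau, [/\ tau <= rho, town tau u, d u v < tau & tau <= d u x]].
Proof.
move=> rho_gt0; have lam_gt0 : 0 < lam by apply: lt_trans lam_gt1.
pose sc j := rho / lam ^+ j.
have sc_gt0 j : 0 < sc j by rewrite divr_gt0// exprn_gt0.
have scS j : sc j = lam * sc j.+1.
  rewrite /sc exprS invfM mulrCA [lam * (lam^-1 * _)]mulrA divff ?mul1r//.
  by rewrite gt_eqF.
have sc_le j : sc j <= rho.
  by rewrite /sc ler_pdivrMr ?exprn_gt0// ler_peMr ?exprn_ege1// ltW.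
(* Invariant of the rounds: the third alternative is a pair still unresolved at scale [sc J], with
   [u] near a hub already found. *)
suff [Q [cardQ xQ QP]] : exists Q : {set X}, [/\ (#|Q| <= eta.+1 ^ J)%N, x \in Q &
  forall u v, d x u <= 2 * (lam * rho) -> d u v <= 2 * (lam * rho) ->
    [\/ exists2 p, p \in Q & d u p + d p v = d u v,
        exists tau, [/\ tau <= rho, town tau u, d u v < tau & tau <= d u x] |
        d u v <= 2 * (lam * sc J) /\ exists2 h, h \in Q & d u h <= 2 * (lam * sc J)]].
  exists Q; split=> // u v xu uv; case: (QP u v xu uv) => [[p pQ pE]|?|]; last 2 first.
  - by right.
  (* The detour through [h] costs at most 2 d(u,h), which is the allowed error. *)
  - case=> uvJ [h hQ uh]; left; exists h => //; rewrite -/(sc J).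
    by have := d_triangle h u v; rewrite (dC h u); lra.
  left; exists p => //; rewrite pE -/(sc J).
  by have := mulr_gt0 lam_gt0 (sc_gt0 J); lra.
elim: J => [|J [Q [cardQ xQ QP]]].
  exists [set x]; split=> [||u v xu uv]; rewrite ?cards1 ?inE//.
  apply: Or33; rewrite /sc expr0 divr1; split=> //.
  by exists x; rewrite ?inE// dC.
have [S SP] := choice (fun h => local_hubs h (sc_gt0 J)).
exists (Q :|: \bigcup_(h in Q) S h); split=> [||u v xu uv]; last 2 first.
- by rewrite inE xQ.
- case: (QP u v xu uv) => [[p pQ pE]|?|]; last 2 first.
  + exact: Or32.
  + case=> uvJ [h hQ uh].
    have [_ /(_ u uh)[hit near]] := SP h.
    have S_Q w : w \in S h -> w \in Q :|: \bigcup_(h in Q) S h.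
      by move=> wS; rewrite inE; apply/orP; right; apply/bigcupP; exists h.
    have sc_lt : sc J.+1 < sc J by rewrite (scS J) ltr_pMl.
    have [le_uv|lt_uv] := leP (sc J) (d u v).
      have [w wS wE] := hit v le_uv uvJ.
      by apply: Or31; exists w => //; exact: S_Q.
    have uvS : d u v <= 2 * (lam * sc J.+1).
      by rewrite -scS; have := sc_gt0 J; lra.
    case: near => [T|[w wS uw]]; last first.
      by apply: Or33; split=> //; exists w; rewrite ?S_Q// -scS.
    (* If the town contains [x], then [x] itself serves as the nearby hub for the next round. *)
    have [ux|xu'] := leP (sc J) (d u x).
      by apply: Or32; exists (sc J).
    apply: Or33; split=> //; exists x; first by rewrite inE xQ.
    by rewrite -scS; have := sc_gt0 J; lra.
  by apply: Or31; exists p => //; rewrite inE pQ.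
rewrite (leq_trans (leq_card_setU _ _))// expnS mulSn leq_add//.
have cup : (#|\bigcup_(h in Q) S h| <= \sum_(h in Q) #|S h|)%N.
  elim/big_ind2 : _ => [|A m B n Am Bn|//]; first by rewrite cards0.
  by rewrite (leq_trans (leq_card_setU _ _))// leq_add.
apply: leq_trans cup _; apply: (@leq_trans (\sum_(h in Q) eta)).
  by apply: leq_sum => h _; case: (SP h).
by rewrite sum_nat_const mulnC leq_mul2l cardQ orbT.
Qed.

(** * The hierarchy of towns around a vertex *)

Variable s : X.

(* Classes: maximal towns of scale at most sigma that do not contain s. *)
Definition same_town (sigma : R) (u v : X) : Prop := u = v \/
  exists tau, [/\ tau <= sigma, town tau u, d u v < tau & tau <= d u s].

Lemma same_town_sym sigma u v : same_town sigma u v -> same_town sigma v u.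
Proof.
move=> [->|[tau [le_tau Tu uv us]]]; [by left|right; exists tau].
split=> //; first exact: town_move Tu uv.
- by rewrite dC.
- by rewrite leNgt (town_mem s Tu uv) -leNgt.
Qed.

(** Of two towns sharing [v], the one of larger scale contains the other. *)
Lemma same_town_trans sigma v u w :
  same_town sigma u v -> same_town sigma v w -> same_town sigma u w.
Proof.
move=> [->//|[tau [le_tau Tu uv us]]] [<-|[tau' [le_tau' Tv vw vs]]].
  by right; exists tau.
right; have [le_tt|/ltW le_tt] := leP tau tau'.
  have vu : d v u < tau' by rewrite dC; apply: lt_le_trans le_tt.
  have Tu' := town_move Tv vu.
  exists tau'; split=> //; first by rewrite (town_mem w Tv vu).
  by rewrite leNgt (town_mem s Tv vu) -leNgt.
exists tau; split=> //; rewrite -(town_mem w Tu uv).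
exact: lt_le_trans le_tt.
Qed.

Lemma same_town_le sigma sigma' u v : sigma <= sigma' ->
  same_town sigma u v -> same_town sigma' u v.
Proof.
move=> le_s [->|[tau [le_tau Tu uv us]]]; [by left|right; exists tau].
by split=> //; apply: le_trans le_s.
Qed.

Lemma same_town_lt sigma u v : 0 < sigma -> same_town sigma u v -> d u v < sigma.
Proof.
move=> s0 [<-|[tau [le_tau _ uv _]]]; first by rewrite dxx.
exact: lt_le_trans le_tau.
Qed.

(* A town avoiding s is closer to itself than to s, so the distance to s varies
   by a factor of at most 2 on it. *)
Lemma town_distance : exists g : X -> R,
  (forall sigma u v, same_town sigma u v -> g u = g v) /\
  (forall u, g u <= d s u /\ d s u <= 2 * g u).
Proof.
(* A town avoiding [s] has scale at most [D], so the classes at scale [D] are the coarsest; [g] is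
   the least distance to [s] on them. *)
pose D : R := \sum_v d s v.
have le_D u : d s u <= D.
  rewrite /D (bigD1 u)//= lerDl; apply: sumr_ge0 => v _; exact: d_ge0.
have to_D sigma u v : same_town sigma u v -> same_town D u v.
  move=> [->|[tau [le_tau Tu uv us]]]; [by left|right; exists tau].
  by split=> //; rewrite (le_trans us)// dC.
pose cls u v := `[< same_town D u v >].
have cls_refl u : cls u u by apply/asboolP; left.
pose m u := [arg min_(v < u | cls u v) d s v]%O.
have mP u : cls u (m u) /\ forall v, cls u v -> d s (m u) <= d s v.
  by rewrite /m; case: arg_minP => //.
exists (fun u => d s (m u)); split=> [sigma u v /to_D uv|u].
  have le_m a b : same_town D a b -> d s (m a) <= d s (m b).
    move=> ab; apply: (proj2 (mP a)); apply/asboolP; apply: same_town_trans ab _.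
    by apply/asboolP; exact: (proj1 (mP b)).
  by apply/eqP; rewrite eq_le !le_m//; exact: same_town_sym.
have [/asboolP um min_m] := mP u; split; first exact: min_m.
have [->|[tau [_ _ mu ms]]] /= := same_town_sym um; first by have := d_ge0 s u; lra.
by have := d_triangle s (m u) u; rewrite (dC s (m u)); lra.
Qed.

Section Hierarchy.
Variables (g : X -> R) (sigma0 : R).
Hypothesis g_town : forall sigma u v, same_town sigma u v -> g u = g v.
Hypothesis g_le : forall u, g u <= d s u.
Hypothesis le_g : forall u, d s u <= 2 * g u.
Hypothesis sigma0_gt0 : 0 < sigma0.

Definition scale (k : nat) : R := sigma0 * lam ^+ k.

Lemma scale_gt0 k : 0 < scale k.
Proof. by rewrite mulr_gt0// exprn_gt0// (lt_trans _ lam_gt1). Qed.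

Lemma scaleS k : scale k.+1 = lam * scale k.
Proof. by rewrite /scale exprS mulrCA. Qed.

Lemma scale_lt k : scale k < scale k.+1.
Proof. by rewrite scaleS ltr_pMl ?scale_gt0. Qed.

Lemma scale_le i j : (i <= j)%N -> scale i <= scale j.
Proof. by move=> ij; rewrite ler_pM2l// ler_weXn2l// ltW. Qed.

Lemma scale_ltP i j : scale i < scale j -> (i < j)%N.
Proof. by move=> lt_ij; rewrite ltnNge; apply/negP => /scale_le; lra. Qed.

(** Using [g], constant on towns, makes the central class a union of towns, hence the relation
    transitive. The factor 2 lam matches towns at level k to the radius 2 [scale k.+1] of the
    portals at level k+1. *)
Definition level_rel (k : nat) (u v : X) : Prop :=
  (g u <= scale k /\ g v <= scale k) \/ same_town (2 * (lam * scale k)) u v.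

Lemma level_refl k u : level_rel k u u.
Proof. by right; left. Qed.

Lemma level_sym k u v : level_rel k u v -> level_rel k v u.
Proof. by move=> [[]|/same_town_sym]; [left|right]. Qed.

Lemma level_trans k v u w : level_rel k u v -> level_rel k v w -> level_rel k u w.
Proof.
move=> [[gu gv]|uv] [[gv' gw]|vw]; first by left.
- by left; rewrite -(g_town vw).
- by left; rewrite (g_town uv).
- by right; apply: same_town_trans uv vw.
Qed.

Lemma level_le i j u v : (i <= j)%N -> level_rel i u v -> level_rel j u v.
Proof.
move=> /scale_le le_ij [[gu gv]|uv]; [left|right].
  by split; apply: le_trans le_ij.
by apply: same_town_le uv; rewrite ler_pM2l// ler_pM2l// (lt_trans _ lam_gt1).
Qed.

Lemma g_s : g s = 0.
Proof.
have := g_le s; have := le_g s; rewrite dxx; lra.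
Qed.

Definition cls (k : nat) (u : X) : {set X} := [set v | `[< level_rel k u v >]].

Lemma in_cls k u v : (v \in cls k u) <-> level_rel k u v.
Proof. by rewrite inE; split => /asboolP. Qed.

Lemma cls_eq k u v : level_rel k u v -> cls k u = cls k v.
Proof.
move=> uv; apply/setP => w; apply/idP/idP => /in_cls w_in; apply/in_cls.
  exact: level_trans (level_sym uv) w_in.
exact: level_trans uv w_in.
Qed.

(** Preferring [s] makes the portals of the central class test towns against [s] itself. *)
Definition centre (A : {set X}) : X :=
  if s \in A then s else odflt s [pick u in A].

Lemma centre_in k u : level_rel k u (centre (cls k u)).
Proof.
rewrite /centre; case: ifP => [/in_cls//|_]; case: pickP => [v /in_cls//|/(_ u)].
by rewrite (proj2 (in_cls k u u) (level_refl k u)).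
Qed.

Lemma centre_cls k u : (g u <= scale k /\ centre (cls k u) = s) \/
  same_town (2 * (lam * scale k)) u (centre (cls k u)).
Proof.
have [gu|gu] := leP (g u) (scale k); [left|right].
  split=> //; rewrite /centre (_ : s \in _ = true)//; apply/in_cls; left.
  by rewrite g_s (ltW (scale_gt0 k)).
by case: (centre_in k u) => // -[]; lra.
Qed.

(** * The tree of classes *)

Variable M : nat.
Hypothesis g_bound : forall u, g u <= scale M.-1.

(** [None] is a root above all classes, to which levels from [M] on collapse. Sets that are not
    classes also give nodes; the tree structure only needs ranks that rise towards the root. *)
Definition node := option ('I_M * {set X}).

Definition level_node (k : nat) (A : {set X}) : node :=
  omap (fun i : 'I_M => (i, A)) (insub k).

Definition parent (t : node) : node :=
  if t is Some (i, A) then level_node i.+1 (cls i.+1 (odflt s [pick u in A]))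
  else None.

Definition node_rank (t : node) : nat :=
  if t is Some (i, _) then i else M.

Lemma node_rank_parent t : t != None -> (node_rank t < node_rank (parent t))%N.
Proof.
case: t => [[i A]|//] _ /=; rewrite /level_node.
by case: insubP => [j _ /= ->|_] //=.
Qed.

Lemma parent_level k u :
  parent (level_node k (cls k u)) = level_node k.+1 (cls k.+1 u).
Proof.
rewrite {1}/level_node; case: insubP => [i _ iE|] /=; last first.
  rewrite -leqNgt => le_Mk; rewrite /level_node insubN// -leqNgt.
  exact: leq_trans le_Mk _.
rewrite iE; congr level_node.
case: pickP => [v /in_cls uv|/(_ u)]; last first.
  by rewrite (proj2 (in_cls k u u) (level_refl k u)).
by apply/esym/cls_eq; apply: level_le uv.
Qed.

Lemma iter_parent_level j k u :
  iter j parent (level_node k (cls k u)) = level_node (j + k) (cls (j + k) u).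
Proof. by elim: j => //= j ->; rewrite parent_level. Qed.

(** * Windows of levels and their portals *)

Variables (eps : R) (J K : nat).
Hypothesis eps_gt0 : 0 < eps.
Hypothesis eps_le1 : eps <= 1.
(** [lamJ] makes the portal error small, [lamK] bounds the window of levels, and [sigma0_le] gives
    every vertex other than [s] a starting level. *)
Hypothesis lamJ : 8 * lam ^+ 2 <= eps * lam ^+ J.
Hypothesis lamK : 16 * lam ^+ 3 <= eps ^+ 2 * lam ^+ K.
Hypothesis sigma0_le : forall u, u != s -> 4 * (lam * sigma0) <= eps * g u.

Local Notation close u v p :=
  (d u p + d p v <= d u v + eps * (d s u + d s v)).

(** The start of the window is the last level at which a detour through the centre of a town class
    costs at most eps x. *)
Lemma level_start : exists start : R -> nat, forall x, 4 * (lam * sigma0) <= eps * x ->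
  4 * (lam * scale (start x)) <= eps * x /\
  eps * x < 4 * (lam * scale (start x).+1).
Proof.
have lam0 : 0 < lam by rewrite (lt_trans _ lam_gt1).
suff /choice[f fP] : forall x, exists k, 4 * (lam * sigma0) <= eps * x ->
    4 * (lam * scale k) <= eps * x /\ eps * x < 4 * (lam * scale k.+1).
  by exists f.
move=> x.
have [n nP] := exists_expr_ge ((eps * x) / sigma0) lam_gt1.
have ex_n : exists n, eps * x < 4 * (lam * scale n.+1).
  exists n; move: nP; rewrite ler_pdivrMr// [lam ^+ n * _]mulrC -/(scale n) => nP.
  rewrite -scaleS; have := scale_lt n; have := scale_lt n.+1.
  by have := scale_gt0 n; lra.
exists (ex_minn ex_n) => x0; case: ex_minnP => -[|k] kP k_min; split=> //.
  by rewrite /scale expr0 mulr1.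
by rewrite leNgt; apply/negP => /k_min; rewrite ltnn.
Qed.

(** Thus at its starting level the class of [u] is a town class, and its node is not the root. *)
Lemma level_start_prop (start : R -> nat) (u : X) :
  4 * (lam * scale (start (g u))) <= eps * g u -> u != s ->
  scale (start (g u)) < g u /\ (start (g u) < M)%N.
Proof.
move=> le_st u_ns.
have gu0 : 0 < g u by have := le_g u; have := d_gt0 u_ns; rewrite dC; lra.
have lt_g : scale (start (g u)) < g u.
  have s0 := scale_gt0 (start (g u)).
  have : scale (start (g u)) < lam * scale (start (g u)) by rewrite ltr_pMl.
  have : eps * g u <= g u by rewrite ler_piMl// ltW.
  lra.
split=> //; have := lt_le_trans lt_g (g_bound u) => /scale_ltP lt_M.
by apply: leq_trans lt_M _; exact: leq_pred.
Qed.

(** From K levels above the start on, a detour through [s] is cheap. One factor eps comes from the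
    definition of the start, the other from the error sought. *)
Lemma above_window k0 k w : eps * g w < 4 * (lam * scale k0.+1) ->
  (k0 + K <= k.+1)%N -> 2 * d s w <= eps * scale k.
Proof.
have lam0 : 0 < lam by rewrite (lt_trans _ lam_gt1).
move=> gw /scale_le; rewrite scaleS {1}/scale exprD mulrA -/(scale k0) => le_k.
rewrite scaleS in gw.
have s0 := scale_gt0 k0.
have : 16 * lam ^+ 3 * scale k0 <= eps ^+ 2 * (lam * scale k).
  apply: le_trans (_ : eps ^+ 2 * lam ^+ K * scale k0 <= _).
    by rewrite ler_pM2r.
  by rewrite -mulrA ler_pM2l ?exprn_gt0// mulrC.
have -> : 16 * lam ^+ 3 * scale k0 = lam * (16 * (lam * (lam * scale k0))).
  by rewrite !exprS expr0 mulr1 [16 * _]mulrC -!mulrA; congr (_ * _); lra.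
rewrite [eps ^+ 2 * _]mulrCA ler_pM2l// => le_eps.
rewrite -(ler_pM2l eps_gt0).
have := ler_wpM2l (ltW eps_gt0) (le_g w).
rewrite [eps * (eps * _)]mulrA -expr2; lra.
Qed.

Lemma portal_error k rho : rho = 2 * scale k.+1 ->
  4 * (lam * (rho / lam ^+ J)) <= eps * scale k.
Proof.
have lam0 : 0 < lam by rewrite (lt_trans _ lam_gt1).
move=> ->; rewrite scaleS; have : 0 < lam ^+ J by rewrite exprn_gt0.
have := ler_wpM2r (ltW (scale_gt0 k)) lamJ.
move: (scale k) (lam ^+ J) => a L; rewrite expr2 => le_a L0.
by rewrite !mulrA ler_pdivrMr//; lra.
Qed.

(** Consider the first level joining [u] and [v]. If it is above the window of one of them, the
    route through [s] is good enough; otherwise the portals of the common class serve the pair. *)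
Lemma level_portals : exists (leaf : X -> node) (Q : node -> 'I_(eta.+1 ^ J) -> X),
  forall u v, u != s -> v != s -> close u v s \/
    exists i j (l : 'I_(eta.+1 ^ J)), [/\ (i < K)%N, (j < K)%N,
      iter i parent (leaf u) = iter j parent (leaf v) &
      close u v (Q (iter i parent (leaf u)) l)].
Proof.
have lam0 : 0 < lam by rewrite (lt_trans _ lam_gt1).
have rho_gt0 k : 0 < 2 * scale k by rewrite mulr_gt0// scale_gt0.
have [start startP] := level_start.
have [P PP] := choice (fun xk : X * nat => portal_set J xk.1 (rho_gt0 xk.2)).
pose Pnode k A := P (centre A, k).
pose Q (t : node) (l : 'I_(eta.+1 ^ J)) : X :=
  if t is Some (i, A) then nth s (enum (Pnode i A)) l else s.
have QP k A p : (k < M)%N -> p \in Pnode k A ->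
    exists l, Q (level_node k A) l = p.
  move=> lt_k pP; have := PP (centre A, k) => -[cardP _ _].
  have lt_i : (index p (enum (Pnode k A)) < eta.+1 ^ J)%N.
    by apply: leq_trans cardP; rewrite cardE index_mem mem_enum.
  exists (Ordinal lt_i); rewrite /level_node insubT /= nth_index//.
  by rewrite mem_enum.
pose leaf u := level_node (start (g u)) (cls (start (g u)) u).
exists leaf, Q => u v u_ns v_ns.
have [Pu1 Pu2] := startP _ (sigma0_le u_ns).
have [Pv1 Pv2] := startP _ (sigma0_le v_ns).
have [Pu3 Pu4] := level_start_prop Pu1 u_ns.
have [Pv3 Pv4] := level_start_prop Pv1 v_ns.
have K_gt0 : (0 < K)%N.
  rewrite lt0n; apply/eqP => K0; move: lamK; rewrite K0 expr0 mulr1.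
  have : 1 <= lam ^+ 3 by rewrite exprn_ege1// ltW.
  have : eps ^+ 2 <= 1 by rewrite exprn_ile1// ltW.
  lra.
have near_centre k w x : level_rel k w x -> scale k < g w -> d w x < 2 * (lam * scale k).
  move=> [[]|wx _]; first by lra.
  by apply: same_town_lt wx; rewrite mulr_gt0// mulr_gt0// scale_gt0.
(* Pairs together at the starting level have equal [g], hence the same leaf, and use the centre of
   their class. *)
have [uv0|nuv0] := pselect (level_rel (start (g u)) u v).
  have guv : g u = g v by case: uv0 => [[]|/g_town//]; lra.
  right; set k := start (g u) in uv0 Pu1 Pu3 Pu4.
  have cE : cls k v = cls k u by apply/esym/cls_eq.
  have [_ cP _] := PP (centre (cls k u), k).
  have [l lE] := QP k (cls k u) _ Pu4 cP.
  exists 0%N, 0%N, l; split=> //=.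
    by rewrite /leaf -guv -/k cE.
  rewrite /leaf -/k lE /=.
  have := near_centre _ _ _ (centre_in k u) Pu3.
  have : scale k < g v by rewrite -guv.
  move=> /(near_centre _ _ _ (centre_in k v)); rewrite cE (dC v).
  move: Pu1; have := d_ge0 u v; have := ler_wpM2l (ltW eps_gt0) (g_le u).
  by have := mulr_ge0 (ltW eps_gt0) (d_ge0 s v); rewrite mulrDr; lra.
have ex_k : exists k, `[< level_rel k u v >].
  by exists M.-1; apply/asboolP; left.
case: (ex_minnP ex_k) => k1 /asboolP uvk k_min.
have k_le_M : (k1 < M)%N.
  have : (k1 <= M.-1)%N by apply: k_min; apply/asboolP; left.
  by move: Pu4; case: (M) => // m; rewrite ltnS.
(* A vertex is outside the central class at its start, so being together there forces equal [g] and
   equal starting levels. *)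
have start_lt w : (w = u \/ w = v) -> (start (g w) < k1)%N.
  have nu : (start (g u) < k1)%N.
    by rewrite ltnNge; apply/negP => le_k; apply: nuv0; exact: level_le le_k uvk.
  move=> [->//|->]; rewrite ltnNge; apply/negP => le_k.
  have := level_le le_k uvk => -[[]|/g_town guv]; first by lra.
  by move: nu; rewrite guv ltnNge le_k.
case: k1 uvk k_min k_le_M start_lt => [|k] uvk k_min k_le_M start_lt.
  by have := start_lt u (or_introl erefl).
have nuvk : ~ level_rel k u v.
  by move=> /asboolP /k_min; rewrite ltnn.
(* Separated at level k, the two are not both in the central class; this turns eps [scale k] into an
   admissible error. *)
have far_s : scale k < d s u + d s v.
  rewrite ltNge; apply/negP => le_k; apply: nuvk; left.
  by have := g_le u; have := g_le v; have := d_ge0 s u; have := d_ge0 s v; lra.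
have eps_far : eps * scale k <= eps * (d s u + d s v).
  by rewrite ler_pM2l// ltW.
have [above_u|win_u] := leqP (start (g u) + K) k.+1.
  left; have := above_window Pu2 above_u.
  have := d_triangle s u v; rewrite (dC u s); lra.
have [above_v|win_v] := leqP (start (g v) + K) k.+1.
  left; have := above_window Pv2 above_v.
  have := d_triangle s v u; rewrite (dC v u) (dC u s); lra.
right.
have {}start_lt : (start (g u) <= k.+1)%N /\ (start (g v) <= k.+1)%N.
  by split; apply/ltnW/start_lt; [left|right].
have cE : cls k.+1 v = cls k.+1 u by apply/esym/cls_eq.
set x := centre (cls k.+1 u).
have [_ cP portal] := PP (x, k.+1).
have lt_lam : scale k.+1 < lam * scale k.+1 by rewrite ltr_pMl// scale_gt0.
have sk0 := scale_gt0 k.+1.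
have scale2 : 0 < 2 * (lam * scale k.+1) by lra.
have xu : d x u <= 2 * (lam * (2 * scale k.+1)).
  case: (centre_cls k.+1 u) => [[gu xs]|]; rewrite -/x.
    by rewrite /x xs; have := le_g u; lra.
  by move=> /(same_town_lt scale2); rewrite dC; lra.
have uv : d u v <= 2 * (lam * (2 * scale k.+1)).
  case: uvk => [[gu gv]|/(same_town_lt scale2)]; last by lra.
  by have := le_g u; have := le_g v; have := d_triangle u s v; rewrite (dC u s); lra.
case: (portal u v xu uv) => [[p pP pE]|[tau [le_tau Tu uvt ux]]].
  have [l lE] := QP k.+1 (cls k.+1 u) p k_le_M pP.
  exists (k.+1 - start (g u))%N, (k.+1 - start (g v))%N, l.
  rewrite /leaf !iter_parent_level !subnK ?cE ?lE; try by case: start_lt.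
  split=> //; try by rewrite ltn_psubLR.
  have := @portal_error k _ erefl; move: pE => /=; lra.
(* A town found by the portal search would already join [u] and [v] at level k, once it is seen to
   avoid [s]. It avoids the centre [x]; if [x] is not [s], the town joining [u] to [x] is larger and
   avoids [s]. *)
case: nuvk; right; right; exists tau; split=> //.
  by move: le_tau => /=; rewrite scaleS.
move: ux => /=; case: (centre_cls k.+1 u) => [[gu xs]|]; rewrite -/x.
  by rewrite /x xs.
case=> [<-|[tau' [_ _ ux' us]]]; last by lra.
by rewrite dxx; have := d_ge0 u v; lra.
Qed.

End Hierarchy.

Lemma portal_hierarchy (eps : R) (J K : nat) : 0 < eps -> eps <= 1 ->
    8 * lam ^+ 2 <= eps * lam ^+ J -> 16 * lam ^+ 3 <= eps ^+ 2 * lam ^+ K ->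
  exists (T : finType) (par : T -> T) (root : T) (rk : T -> nat)
    (leaf : X -> T) (Q : T -> 'I_(eta.+1 ^ J) -> X),
  [/\ par root = root,
      forall t, t != root -> (rk t < rk (par t))%N &
      forall u v, u != s -> v != s ->
        d u s + d s v <= d u v + eps * (d s u + d s v) \/
        exists i j (l : 'I_(eta.+1 ^ J)), [/\ (i < K)%N, (j < K)%N,
          iter i par (leaf u) = iter j par (leaf v) &
          let p := Q (iter i par (leaf u)) l in
          d u p + d p v <= d u v + eps * (d s u + d s v)]].
Proof.
move=> eps0 eps1 lamJ lamK; have [g [g_town gP]] := town_distance.
have lam0 : 0 < lam by rewrite (lt_trans _ lam_gt1).
(* The cap 1 also gives a value when [s] is the only point. Then [sigma0] is chosen so that 4 lam
   sigma0 = eps m. *)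
pose m := \big[Num.min/1]_(u | u != s) g u.
have m_gt0 : 0 < m.
  rewrite /m; apply/bigmin_gtP; split=> // u u_ns.
  by have [_] := gP u; have := d_gt0 u_ns; rewrite dC; lra.
pose sigma0 := eps * m / (4 * lam).
have lam4 : 0 < 4 * lam by rewrite mulr_gt0.
have sigma0_gt0 : 0 < sigma0 by rewrite divr_gt0// mulr_gt0.
have sigma0_le u : u != s -> 4 * (lam * sigma0) <= eps * g u.
  move=> u_ns; rewrite mulrA /sigma0 mulrC divfK ?gt_eqF// ler_pM2l//.
  exact: bigmin_le_cond.
have [n nP] := exists_expr_ge ((\sum_v d s v) / sigma0) lam_gt1.
have g_bound u : g u <= scale sigma0 n.+1.-1.
  apply: le_trans (proj1 (gP u)) _; move: nP; rewrite ler_pdivrMr// mulrC.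
  apply: le_trans; rewrite (bigD1 u)//= lerDl.
  by apply: sumr_ge0 => v _; exact: d_ge0.
have [leaf [Q QP]] := level_portals g_town (fun u => proj1 (gP u))
  (fun u => proj2 (gP u)) sigma0_gt0 g_bound eps0 eps1 lamJ lamK sigma0_le.
exists (node n.+1), (parent g sigma0 (M := n.+1)), None, (@node_rank n.+1), leaf, Q.
by split=> //; exact: node_rank_parent.
Qed.

End HubMetric.

(** * The portal graph *)

Section PortalGraph.
Variables (R : realType) (G : wgraph R) (s : G).

(** On the component of [s] distances are finite; a pair with a vertex outside it has an infinite
    upper bound, unless the two are equal. *)
Definition component := {u : G | connect (@edge R G) s u}.

Definition cdist (x y : component) : R := fine (dist (val x) (val y)).

Lemma component_connect (x y : component) : connect (@edge R G) (val x) (val y).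
Proof.
by apply: connect_trans (valP y); rewrite connect_edge_sym; exact: valP.
Qed.

Lemma cdistE (x y : component) : dist (val x) (val y) = (cdist x y)%:E.
Proof. by rewrite fineK// dist_fin_num// component_connect. Qed.

Lemma cdistxx x : cdist x x = 0.
Proof. by rewrite /cdist distxx. Qed.

Lemma cdist_gt0 x y : x != y -> 0 < cdist x y.
Proof.
move=> x_ny; rewrite -lte_fin -cdistE lt_neqAle dist_ge0 andbT eq_sym.
by apply: contra x_ny => /eqP/dist_eq0/val_inj ->.
Qed.

Lemma cdistC x y : cdist x y = cdist y x.
Proof. by rewrite /cdist dist_sym. Qed.

Lemma cdist_triangle x y z : cdist x z <= cdist x y + cdist y z.
Proof. by rewrite -lee_fin EFinD -!cdistE; exact: dist_triangle. Qed.

(** Each vertex of a shortest path splits the distance additively, so the metric condition puts the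
    whole path into the ball. *)
Lemma highway_component_hubs (c : R) (eta : nat) : highway_bound G c eta ->
  forall h rho, 0 < rho -> exists S : {set component},
  (#|S| <= eta)%N /\
  forall a b, (forall z, cdist a z + cdist z b = cdist a b ->
      cdist z h <= 4 * (c / 4 * rho)) ->
    rho <= cdist a b ->
    exists2 w, w \in S & cdist a w + cdist w b = cdist a b.
Proof.
move=> Gc h rho rho_gt0; have [S [_ cardS hitS]] := Gc rho (val h) rho_gt0.
have cE : 4 * (c / 4 * rho) = c * rho by lra.
exists [set x | val x \in S]; split.
  apply: leq_trans cardS; rewrite -(card_imset _ val_inj).
  by apply: subset_leq_card; apply/fintype.subsetP => _ /imsetP[x + ->]; rewrite inE.
move=> a b ball_ab le_ab.
have [p p_sp] := dist_attained (component_connect a b).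
have on_path w : w \in val a :: p ->
    exists2 x : component, val x = w & cdist a x + cdist x b = cdist a b.
  move=> w_p; have := shortest_path_between p_sp w_p => le_w.
  have s_w : connect (@edge R G) s w.
    apply: connect_trans (valP a) _; apply: dist_fin_connect.
    rewrite ge0_fin_numE ?dist_ge0//; apply: le_lt_trans (ltry (cdist a b)).
    by rewrite -cdistE; apply: le_trans le_w; rewrite leeDl ?dist_ge0.
  exists (Sub w s_w : component) => //; apply/eqP; rewrite eq_le cdist_triangle andbT.
  by rewrite -lee_fin EFinD -!cdistE.
have [||w wS w_p] := hitS _ _ _ p_sp.
- move=> w /on_path[x <- /ball_ab]; rewrite cE inE cdistE lee_fin; exact.
- by rewrite -lee_fin (proj2 p_sp) cdistE lee_fin.
- by have [x xE xb] := on_path w w_p; exists x; rewrite ?inE ?xE.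
Qed.

Variables (T : finType) (par : T -> T) (root : T) (rk : T -> nat).
Variables (leaf : component -> T) (N K : nat) (Q : T -> 'I_N -> component).
Variable e : R.
Hypothesis par_root : par root = root.
Hypothesis rk_par : forall t, t != root -> (rk t < rk (par t))%N.
Hypothesis e_gt0 : 0 < e.
Hypothesis K_gt0 : (0 < K)%N.

Definition leafG (u : G) : T := oapp leaf root (insub u).

Definition spoke (u v : G) : bool :=
  [&& u == s, v != s & connect (@edge R G) s v].

Definition to_portal (u : G) (w : T * 'I_N) : bool :=
  [&& u != s, connect (@edge R G) s u &
      [exists j : 'I_K, iter j par (leafG u) == w.1]].

Definition portal (w : T * 'I_N) : G := val (Q w.1 w.2).

(** Right summands are copies of portals, one per node and index: a vertex of [G] serving as portal
    at many nodes is not reused. *)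
Definition portal_edge (a b : G + T * 'I_N) : bool :=
  match a, b with
  | inl u, inl v => spoke u v || spoke v u
  | inl u, inr w | inr w, inl u => to_portal u w
  | inr _, inr _ => false
  end.

(* The extra term keeps the edge from u to a copy of u itself at positive
   length. *)
Definition portal_len (a b : G + T * 'I_N) : R :=
  match a, b with
  | inl u, inl v => fine (dist u v)
  | inl u, inr w | inr w, inl u => fine (dist u (portal w)) + e * fine (dist s u)
  | inr _, inr _ => 0
  end.

Lemma portal_edge_sym : symmetric portal_edge.
Proof. by move=> [u|w] [v|w'] //=; rewrite orbC. Qed.

Lemma portal_edge_irr : irreflexive portal_edge.
Proof. by move=> [u|w] //=; rewrite /spoke; case: eqP. Qed.

Lemma portal_len_sym a b : portal_len a b = portal_len b a.
Proof. by case: a b => [u|w] [v|w'] //=; rewrite dist_sym. Qed.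

Lemma fine_dist_ge0 (u v : G) : 0 <= fine (dist u v).
Proof. exact/fine_ge0/dist_ge0. Qed.

Lemma dist_s_gt0 u : u != s -> connect (@edge R G) s u -> 0 < fine (dist s u).
Proof.
move=> u_ns su.
have := @cdist_gt0 (Sub s (connect0 _ s)) (Sub u su); rewrite /cdist /=.
by apply; rewrite -val_eqE /= eq_sym.
Qed.

Lemma portal_len_gt0 a b : portal_edge a b -> 0 < portal_len a b.
Proof.
have spoke_gt0 u v : spoke u v -> 0 < fine (dist u v).
  by move=> /and3P[/eqP -> v_ns sv]; exact: dist_s_gt0.
have to_portal_gt0 u w : to_portal u w ->
    0 < fine (dist u (portal w)) + e * fine (dist s u).
  move=> /and3P[u_ns su _].
  by rewrite ltr_wpDl ?fine_dist_ge0// mulr_gt0// dist_s_gt0.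
case: a b => [u|w] [v|w'] //=; [|exact: to_portal_gt0..].
by move=> /orP[/spoke_gt0//|/spoke_gt0]; rewrite dist_sym.
Qed.

Definition portal_graph : wgraph R :=
  WGraph portal_edge_sym portal_edge_irr portal_len_sym portal_len_gt0.

(** Each vertex of [G] gets its own leaf below its node, with a bag that holds its neighbours among
    the portals and [s]. *)
Definition tree_par (t : T + G) : T + G :=
  match t with inl t => inl (par t) | inr u => inl (leafG u) end.

Definition tree_rk (t : T + G) : nat :=
  match t with inl t => (rk t).+1 | inr _ => 0%N end.

Definition node_bag (t : T) : {set portal_graph} :=
  inl s |: [set inr (iter jl.1 par t, jl.2) | jl : 'I_K * 'I_N].

Definition tree_bag (t : T + G) : {set portal_graph} :=
  match t with inl t => node_bag t | inr u => inl u |: node_bag (leafG u) end.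

Definition tree_top (a : portal_graph) : T + G :=
  match a with
  | inl u => if u == s then inl root else inr u
  | inr w => inl w.1
  end.

Lemma node_bag_inl t u : (inl u \in node_bag t) = (u == s).
Proof.
rewrite !inE orbC; case: imsetP => [[jl _ //]|_] /=.
by apply/eqP/eqP => [[]|->].
Qed.

Lemma node_bag_inr t w : reflect (exists2 j, (j < K)%N & iter j par t = w.1)
  (inr w \in node_bag t).
Proof.
rewrite !inE /=; apply: (iffP imsetP) => [[[j l] _ [-> /=]]|[j lt_j jE]].
  by exists j.
by exists (Ordinal lt_j, w.2); rewrite //= jE; case: w {jE}.
Qed.

(** [s] lies in all bags, any other vertex of [G] only in its own, and a portal copy in bags at
    nodes fewer than K steps below its node and at leaves hung there. *)
Lemma portal_graph_treewidth : (treewidth portal_graph <= K * N + 1)%N.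
Proof.
have iter_root j : iter j par root = root by elim: j => //= j ->.
apply: (@treewidth_le_of_parent _ tree_par (inl root) tree_rk _ _ _ _
          tree_bag tree_top).
- by rewrite /= par_root.
- by move=> [t|u] //= t_nroot; rewrite ltnS rk_par//; apply: contra t_nroot => /eqP ->.
- move=> [u|w] /=; last by apply/node_bag_inr; exists 0%N.
  have [->|u_ns] := eqVneq u s; first by rewrite /= node_bag_inl.
  by rewrite /= in_setU1 eqxx.
- move=> [u|w] [t|v] /=.
  + rewrite node_bag_inl => /eqP ->; rewrite eqxx => t_nroot; split=> //.
    by rewrite node_bag_inl.
  + rewrite in_setU1 node_bag_inl => /orP[/eqP[->]|/eqP ->].
      by have [->|v_ns] := eqVneq v s; rewrite ?eqxx//; split=> //; rewrite node_bag_inl.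
    by move=> _; split=> //; rewrite /= node_bag_inl eqxx.
  (* For j = 0 the node is the top of the copy; otherwise its parent is one step closer. *)
  + move=> /node_bag_inr[[|j] lt_j jE] t_n; first by rewrite -jE eqxx in t_n.
    split.
      by apply: contra t_n => /eqP[tE]; rewrite -jE tE iter_root.
    by apply/node_bag_inr; exists j; rewrite ?(ltnW lt_j)// -iterSr.
  + by rewrite in_setU1 => /orP[/eqP//|].
- have spoke_bag u v : spoke u v -> inl u \in tree_bag (inr v).
    by move=> /and3P[/eqP -> _ _]; rewrite /= in_setU1 node_bag_inl eqxx orbT.
  have self_bag u : inl u \in tree_bag (inr u) by rewrite /= in_setU1 eqxx.
  have portal_bag u w : to_portal u w -> inr w \in tree_bag (inr u).
    move=> /and3P[_ _ /existsP[j /eqP jE]]; rewrite /= in_setU1.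
    by apply/orP; right; apply/node_bag_inr; exists j.
  move=> [u|w] [v|w'] //=.
  + move=> /orP[/spoke_bag u_in|/spoke_bag v_in].
      by exists (inr v); rewrite u_in self_bag.
    by exists (inr u); rewrite v_in self_bag.
  + by move=> /portal_bag w_in; exists (inr u); rewrite w_in self_bag.
  + by move=> /portal_bag w_in; exists (inr v); rewrite w_in self_bag.
- have card_node t : (#|node_bag t| <= K * N + 1)%N.
    rewrite cardsU1 addnC leq_add ?leq_b1// (leq_trans (leq_imset_card _ _))//.
    by rewrite card_prod !card_ord.
  move=> [t|u] /=; first exact: leqW.
  by rewrite cardsU1 -[(_ + 1).+1]add1n leq_add ?leq_b1.
Qed.

(** Projecting copies to their portals never increases distances, which gives the lower bound. *)
Definition portal_proj (a : portal_graph) : G :=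
  match a with inl u => u | inr w => portal w end.

Lemma dist_le_portal_len a b : portal_edge a b ->
  (dist (portal_proj a) (portal_proj b) <= (portal_len a b)%:E)%E.
Proof.
have finE u v : connect (@edge R G) s u -> connect (@edge R G) s v ->
    dist u v = (fine (dist u v))%:E.
  by move=> su sv; rewrite (@cdistE (Sub u su) (Sub v sv)).
have spoke_le u v : spoke u v -> (dist u v <= (fine (dist u v))%:E)%E.
  by move=> /and3P[/eqP -> _ sv]; rewrite {1}finE.
have to_portal_le u w : to_portal u w ->
    (dist u (portal w) <= (fine (dist u (portal w)) + e * fine (dist s u))%:E)%E.
  move=> /and3P[_ su _]; rewrite {1}finE ?lee_fin//; last exact: valP.
  by rewrite lerDl mulr_ge0 ?fine_dist_ge0// ltW.
case: a b => [u|w] [v|w'] //=; first last.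
- by rewrite dist_sym; exact: to_portal_le.
- exact: to_portal_le.
by move=> /orP[/spoke_le//|/spoke_le]; rewrite dist_sym.
Qed.

Lemma dist_le_portal_dist (a b : portal_graph) :
  (dist (portal_proj a) (portal_proj b) <= dist a b)%E.
Proof.
apply: le_dist => p + <-; elim: p a => [|w p IH] a /=; first by rewrite distxx.
move=> /andP[/dist_le_portal_len le_aw /IH le_p].
by rewrite EFinD; apply: le_trans (dist_triangle _ _ _) (leeD le_aw le_p).
Qed.

Hypothesis Q_close : forall u v : component, val u != s -> val v != s ->
  let s' := Sub s (connect0 _ s) in
  cdist u s' + cdist s' v <= cdist u v + e * (cdist s' u + cdist s' v) \/
  exists i j (l : 'I_N), [/\ (i < K)%N, (j < K)%N,
    iter i par (leaf u) = iter j par (leaf v) &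
    let p := Q (iter i par (leaf u)) l in
    cdist u p + cdist p v <= cdist u v + e * (cdist s' u + cdist s' v)].

(** One [e] pays for the detour, the other for the extra lengths of the two portal edges. *)
Lemma portal_dist_le (u v : G) :
  (dist (inl u : portal_graph) (inl v)
     <= dist u v + (2 * e)%:E * (dist s u + dist s v))%E.
Proof.
have e2 : 0 < 2 * e by rewrite mulr_gt0.
have rhs_ge0 : (0 <= dist u v + (2 * e)%:E * (dist s u + dist s v))%E.
  by rewrite adde_ge0 ?dist_ge0// mule_ge0 ?lee_fin ?(ltW e2)// adde_ge0 ?dist_ge0.
have [uv|u_nv] := eqVneq u v; first by rewrite {1}uv distxx.
have dNy (x y : G) : dist x y != -oo%E.
  by rewrite gt_eqF// (lt_le_trans _ (dist_ge0 _ _))// ltNyr.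
have [su|/dist_pinfty su] := boolP (connect (@edge R G) s u); last first.
  by rewrite su addye// gt0_muley ?lte_fin// addey// leey.
have [sv|/dist_pinfty sv] := boolP (connect (@edge R G) s v); last first.
  by rewrite sv addey// gt0_muley ?lte_fin// addey// leey.
pose u' : component := Sub u su; pose v' : component := Sub v sv.
pose s' : component := Sub s (connect0 _ s).
have uvE : dist u v = (cdist u' v')%:E := cdistE u' v'.
have suE : dist s u = (cdist s' u')%:E := cdistE s' u'.
have svE : dist s v = (cdist s' v')%:E := cdistE s' v'.
rewrite uvE suE svE -(EFinD (cdist s' u')) -EFinM -EFinD.
have su0 : 0 <= cdist s' u' by exact: fine_dist_ge0.
have sv0 : 0 <= cdist s' v' by exact: fine_dist_ge0.
have esum0 : 0 <= e * (cdist s' u' + cdist s' v') by rewrite mulr_ge0 ?addr_ge0// ltW.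
have walk_le (p : seq portal_graph) (x : R) :
    path (@edge R portal_graph) (inl u) p -> last (inl u) p = inl v ->
    path_len (inl u : portal_graph) p <= x ->
    (dist (inl u : portal_graph) (inl v) <= x%:E)%E.
  by move=> pp lp le_x; rewrite (le_trans (dist_le_walk pp lp)).
have [uE|u_ns] := eqVneq u s.
  apply: (walk_le [:: inl v]) => //=.
    by rewrite /spoke uE eqxx sv andbT eq_sym -uE u_nv.
  by rewrite addr0 -[fine _]/(cdist u' v'); lra.
have [vE|v_ns] := eqVneq v s.
  apply: (walk_le [:: inl v]) => //=.
    by rewrite /spoke vE eqxx su !andbT u_ns orbT.
  by rewrite addr0 -[fine _]/(cdist u' v'); lra.
have [close_s|[i [j [l [lt_i lt_j ijE close_p]]]]] := @Q_close u' v' u_ns v_ns.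
  apply: (walk_le [:: inl s; inl v]) => //=.
    by rewrite /spoke !eqxx u_ns v_ns su sv /= orbT.
  rewrite addr0 -[fine (dist u s)]/(cdist u' s').
  by rewrite -[fine (dist s v)]/(cdist s' v'); move: close_s; rewrite -/s'; lra.
pose t := iter i par (leaf u').
have leafE w sw : leafG w = leaf (Sub w sw) by rewrite /leafG insubT.
apply: (walk_le [:: inr (t, l); inl v]) => //=.
  rewrite /to_portal u_ns v_ns su sv /= andbT; apply/andP; split; apply/existsP.
    by exists (Ordinal lt_i); rewrite /= leafE.
  by exists (Ordinal lt_j); rewrite /= leafE /t ijE.
rewrite addr0 /portal /= -[fine (dist u _)]/(cdist u' (Q t l)).
rewrite -[fine (dist s u)]/(cdist s' u') -[fine (dist s v)]/(cdist s' v').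
rewrite -[fine (dist v _)]/(cdist v' (Q t l)) (cdistC v').
by move: close_p; rewrite /= -/t -/s'; lra.
Qed.

End PortalGraph.

(** * Choice of parameters, uniform in the graph *)

Lemma low_treewidth_embedding (R : realType) (c eps : R) (eta : nat) :
    4 < c -> 0 < eps ->
  exists k, forall (G : wgraph R) (s : G), highway_bound G c eta ->
  exists (H : wgraph R) (phi : G -> H),
    [/\ injective phi, (treewidth H <= k)%N &
        forall u v : G,
          (dist u v <= dist (phi u) (phi v))%E /\
          (dist (phi u) (phi v)
             <= dist u v + eps%:E * (dist s u + dist s v))%E].
Proof.
(* Halving absorbs the factor 2 of the portal graph; the minimum ensures e <= 1. *)
move=> hc eps_gt0; pose lam := c / 4; pose e := Num.min eps 1 / 2.
have lam1 : 1 < lam by rewrite /lam; lra.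
have min_gt0 : 0 < Num.min eps 1 by rewrite lt_min eps_gt0 ltr01.
have e_gt0 : 0 < e by rewrite divr_gt0.
have e_le1 : e <= 1.
  have : Num.min eps 1 <= 1 by rewrite ge_min lexx orbT.
  by rewrite /e; lra.
have e2_le : 2 * e <= eps.
  by rewrite /e mulrC divfK ?pnatr_eq0// ge_min lexx.
have [J JP] := exists_expr_ge (8 * lam ^+ 2 / e) lam1.
have [K KP] := exists_expr_ge (16 * lam ^+ 3 / e ^+ 2) lam1.
have {}JP : 8 * lam ^+ 2 <= e * lam ^+ J by rewrite [e * _]mulrC -ler_pdivrMr.
have {}KP : 16 * lam ^+ 3 <= e ^+ 2 * lam ^+ K.
  by rewrite [e ^+ 2 * _]mulrC -ler_pdivrMr ?exprn_gt0.
(* The successor makes the window length positive. *)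
exists (K.+1 * eta.+1 ^ J + 1)%N => G s /highway_component_hubs hubs.
have KP1 : 16 * lam ^+ 3 <= e ^+ 2 * lam ^+ K.+1.
  apply: le_trans KP _; rewrite ler_pM2l ?exprn_gt0//.
  by rewrite ler_weXn2l// ltW.
have [T [par [root [rk [leaf [Q [par_root rk_par QP]]]]]]] :=
  portal_hierarchy (@cdistxx _ G s) (@cdist_gt0 _ G s) (@cdistC _ G s)
    (@cdist_triangle _ G s) lam1 (hubs s) (Sub s (connect0 _ s)) e_gt0 e_le1 JP KP1.
exists (portal_graph par root leaf K.+1 Q e_gt0), inl; split=> [u v [//]||u v].
  exact: (portal_graph_treewidth leaf Q par_root rk_par e_gt0).
split; first exact: (dist_le_portal_dist (inl u) (inl v)).
apply: le_trans (portal_dist_le root e_gt0 _ u v) _.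
  move=> a b a_ns b_ns; by apply: QP; rewrite -val_eqE.
by rewrite leeD2l// lee_wpmul2r ?lee_fin// adde_ge0 ?dist_ge0.
Qed.

Theorem theorem3 (R : realType) (c : R) (hc : 4 < c) :
  exists f : R -> nat -> nat,
    forall (eps : R) (eta : nat) (G : wgraph R) (s : G),
      0 < eps -> highway_dim G c = eta ->
      exists (H : wgraph R) (phi : G -> H),
        [/\ injective phi,
            (treewidth H <= f eps eta)%N &
            forall u v : G,
              (dist u v <= dist (phi u) (phi v))%E /\
              (dist (phi u) (phi v)
                 <= dist u v + eps%:E * (dist s u + dist s v))%E].
Proof.
(* Choice needs a value at every pair; nonpositive eps gets 0. *)
have /choice[f fP] (x : R * nat) : exists k, 0 < x.1 ->
    forall (G : wgraph R) (s : G), highway_bound G c x.2 ->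
    exists (H : wgraph R) (phi : G -> H),
      [/\ injective phi, (treewidth H <= k)%N &
          forall u v : G,
            (dist u v <= dist (phi u) (phi v))%E /\
            (dist (phi u) (phi v)
               <= dist u v + x.1%:E * (dist s u + dist s v))%E].
  have [x0|x0] := ltP 0 x.1; last by exists 0%N.
  by have [k kP] := low_treewidth_embedding x.2 hc x0; exists k.
exists (fun eps eta => f (eps, eta)) => eps eta G s eps_gt0 <-.
apply: fP => //; rewrite /highway_dim.
by case: ex_minnP => k /asboolP.
Qed.
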